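(* Let $S=\Bbbk[x_1,\ldots,x_n]$ with $\Bbbk$ a field, let $M$ be a finitely generated $\mathbb N^n$-graded $S$-module, and let $i$ be an integer. If $H^i_{\mathfrak m}(M)$ is finitely generated (i.e. has finite length), then the $\mathbb Z^n$-graded translate $H^i_{\mathfrak m}(M)(-\mathbf 1)$ up by $\mathbf 1=(1,\ldots,1)$ is also $\mathbb N^n$-graded.
   Context: $\mathfrak m=\langle x_1,\ldots,x_n\rangle$. $S$ is $\mathbb Z^n$-graded with $\mathbf x^{\mathbf b}$ in degree $\mathbf b$. A $\mathbb Z^n$-graded module $N$ is called $\mathbb N^n$-graded if $N_{\mathbf b}=0$ for all $\mathbf b\in\mathbb Z^n\smallsetminus\mathbb N^n$. The translate $N(-\mathbf 1)$ is defined by $N(-\mathbf 1)_{\mathbf b}=N_{\mathbf b-\mathbf 1}$. *)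

(* Defs.v *)
From HB Require Import structures.
From mathcomp Require Import all_boot all_order all_algebra.
From mathcomp Require Import boolp.
From mathcomp Require Import mpoly.

Set Implicit Arguments.
Unset Strict Implicit.
Unset Printing Implicit Defensive.

Import GRing.Theory.
Local Open Scope ring_scope.
Local Open Scope quotient_scope.

Definition zdeg (n : nat) := {ffun 'I_n -> int}.

Section GradedModules.
Variables (k : fieldType) (n : nat).
Local Notation S := {mpoly k[n]}.
Local Notation deg := (zdeg n).

Definition mnm_deg (m : 'X_{1..n}) : deg := [ffun j => (m j)%:Z].

(* The degree [a] part of S; it is 0 when [a] has a negative coordinate. *)
Definition S_comp (a : deg) (f : S) : Prop :=
  forall m, m \in msupp f -> mnm_deg m = a.

Record is_grading (M : lmodType S) (comp : deg -> M -> Prop) : Prop :=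
  IsGrading {
    grading0 : forall b, comp b 0;
    gradingB : forall b x y, comp b x -> comp b y -> comp b (x - y);
    gradingZ : forall a b f x, S_comp a f -> comp b x -> comp (a + b) (f *: x);
    grading_span : forall x, exists (s : seq deg) (c : deg -> M),
      [/\ uniq s, forall b, comp b (c b) & x = \sum_(b <- s) c b];
    grading_free : forall (s : seq deg) (c : deg -> M),
      uniq s -> (forall b, comp b (c b)) -> \sum_(b <- s) c b = 0 ->
      forall b, b \in s -> c b = 0
  }.

Record gmod := GMod {
  gmod_sort :> lmodType S;
  gcomp : deg -> gmod_sort -> Prop;
  gcompP : is_grading gcomp
}.

Record ghom (M N : gmod) := GHom {
  ghom_fun :> {linear M -> N};
  ghomP : forall b x, gcomp b x -> gcomp b (ghom_fun x)
}.

Definition nat_graded (M : gmod) : Prop :=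
  forall b : deg, ~ (forall j, 0 <= b j) -> forall x : M, gcomp b x -> x = 0.

Definition fin_gen (M : lmodType S) : Prop :=
  exists (r : nat) (g : 'I_r -> M),
    forall x, exists c : 'I_r -> S, x = \sum_(i < r) c i *: g i.

Section BasicTheory.
Variable M : gmod.

Lemma gcomp0 b : gcomp b (0 : M).
Proof. exact: grading0 (gcompP M) b. Qed.

Lemma gcompB b (x y : M) : gcomp b x -> gcomp b y -> gcomp b (x - y).
Proof. exact: gradingB (gcompP M) b x y. Qed.

Lemma gcompZ a b f (x : M) : S_comp a f -> gcomp b x -> gcomp (a + b) (f *: x).
Proof. exact: gradingZ (gcompP M) a b f x. Qed.

Lemma gcomp_span (x : M) : exists (s : seq deg) (c : deg -> M),
  [/\ uniq s, forall b, gcomp b (c b) & x = \sum_(b <- s) c b].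
Proof. exact: grading_span (gcompP M) x. Qed.

Lemma gcomp_free (s : seq deg) (c : deg -> M) :
  uniq s -> (forall b, gcomp b (c b)) -> \sum_(b <- s) c b = 0 ->
  forall b, b \in s -> c b = 0.
Proof. exact: grading_free (gcompP M) s c. Qed.

Lemma gcomp_inj (s s' : seq deg) (c c' : deg -> M) :
    uniq s -> uniq s' ->
    (forall b, gcomp b (c b)) -> (forall b, gcomp b (c' b)) ->
    \sum_(b <- s) c b = \sum_(b <- s') c' b ->
  forall b, b \in s -> c b = if b \in s' then c' b else 0.
Proof.
move=> us us' hc hc' e b bs.
pose u := undup (s ++ s').
have ext (t : seq deg) (f : deg -> M) : uniq t -> {subset t <= u} ->
    \sum_(b <- t) f b = \sum_(b <- u) (if b \in t then f b else 0).
  move=> ut tu; rewrite -big_mkcond -[RHS]big_filter.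
  apply: perm_big; apply: uniq_perm => //; first by rewrite filter_uniq ?undup_uniq.
  by move=> z; rewrite mem_filter; case zt: (z \in t) => //=; rewrite (tu _ zt).
have su : {subset s <= u} by move=> z zs; rewrite mem_undup mem_cat zs.
have s'u : {subset s' <= u} by move=> z zs; rewrite mem_undup mem_cat zs orbT.
move/eqP: e; rewrite (ext _ c us su) (ext _ c' us' s'u) -subr_eq0 -sumrB => /eqP e.
have hd d : gcomp d ((if d \in s then c d else 0) - (if d \in s' then c' d else 0)).
  by apply: gcompB; case: ifP => _; rewrite ?gcomp0 //; exact: gcomp0.
have := gcomp_free (undup_uniq _) hd e (su _ bs).
by rewrite bs => /eqP; rewrite subr_eq0 => /eqP.
Qed.

End BasicTheory.

Lemma translate_is_grading (M : gmod) (a : deg) :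
  is_grading (fun b (x : M) => gcomp (b - a) x).
Proof.
split.
- by move=> b; exact: gcomp0.
- by move=> b x y; exact: gcompB.
- by move=> c b f x hf hx; rewrite -addrA; exact: gcompZ.
- move=> x; have [s [c [us hc ->]]] := gcomp_span x.
  exists [seq b + a | b <- s], (fun b => c (b - a)); split=> //.
    by rewrite map_inj_uniq //; exact: addIr.
  by rewrite big_map; apply: eq_bigr => b _; rewrite addrK.
- move=> s c us hc e b bs.
  have := @gcomp_free M [seq b - a | b <- s] (fun b => c (b + a)).
  rewrite map_inj_uniq => [/(_ us)|]; last exact: addIr.
  move=> /(_ _ _ (b - a)); rewrite subrK; apply.
  + by move=> d; rewrite -{1}[d](addrK a).
  + by rewrite big_map -[RHS]e; apply: eq_bigr => d _; rewrite subrK.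
  + exact: (map_f (fun b : deg => b - a)) bs.
Qed.

(* M(-a), with M(-a)_b = M_(b - a). *)
Definition translate (M : gmod) (a : deg) : gmod :=
  GMod (translate_is_grading M a).

Record gsubmod (M : gmod) := GSubmod {
  gsubmod_pred :> M -> Prop;
  gsubmod0 : gsubmod_pred 0;
  gsubmodD : forall x y, gsubmod_pred x -> gsubmod_pred y -> gsubmod_pred (x + y);
  gsubmodZ : forall f x, gsubmod_pred x -> gsubmod_pred (f *: x);
  gsubmod_homog : forall (s : seq deg) (c : deg -> M),
    uniq s -> (forall b, gcomp b (c b)) -> gsubmod_pred (\sum_(b <- s) c b) ->
    forall b, b \in s -> gsubmod_pred (c b)
}.

Section Sub.
Variables (M : gmod) (P : gsubmod M).

Definition gsubmod_mem : {pred M} := fun x => `[< P x >].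

Lemma gsubmod_memP x : reflect (P x) (x \in gsubmod_mem).
Proof. exact: asboolP. Qed.

Lemma gsubmod_mem_closed : GRing.submod_closed gsubmod_mem.
Proof.
split; first by apply/gsubmod_memP; exact: gsubmod0.
move=> f x y /gsubmod_memP hx /gsubmod_memP hy; apply/gsubmod_memP.
by apply: gsubmodD => //; exact: gsubmodZ.
Qed.

HB.instance Definition _ :=
  GRing.isSubmodClosed.Build S M gsubmod_mem gsubmod_mem_closed.

Record gsub_type := GSub { gsub_val :> M; gsub_valP : gsub_val \in gsubmod_mem }.

HB.instance Definition _ := [isSub for gsub_val].
HB.instance Definition _ := [Choice of gsub_type by <:].
HB.instance Definition _ := [SubChoice_isSubLmodule of gsub_type by <:].

Lemma gsub_is_grading :
  is_grading (fun b (x : gsub_type) => gcomp b (val x)).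
Proof.
split.
- by move=> b; rewrite raddf0; exact: gcomp0.
- by move=> b x y hx hy; rewrite raddfB; exact: gcompB.
- by move=> a b f x hf hx; rewrite linearZ; exact: gcompZ.
- move=> x; have [s [c [us hc e]]] := gcomp_span (val x).
  have hP b : b \in s -> c b \in gsubmod_mem.
    move=> bs; apply/gsubmod_memP/(gsubmod_homog us hc) => //.
    by rewrite -e; exact/gsubmod_memP/gsub_valP.
  exists s, (fun b => insubd (0 : gsub_type) (c b)); split=> //.
    by move=> b; rewrite val_insubd; case: ifP => _; [exact: hc|exact: gcomp0].
  apply: val_inj; rewrite e raddf_sum; apply: eq_big_seq => b bs.
  by rewrite [RHS]insubdK ?hP.
- move=> s c us hc e b bs; apply: val_inj; rewrite raddf0.
  apply: (gcomp_free us (c := fun b => val (c b))) => //.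
  by rewrite -raddf_sum e raddf0.
Qed.

Definition gsub : gmod := GMod gsub_is_grading.

End Sub.

Section Quotient.
Variables (M : gmod) (P : gsubmod M).

Definition gquot_type := Quotient.quot (gsubmod_mem P).
HB.instance Definition _ := GRing.Zmodule.on gquot_type.

Definition gquot_pi (x : M) : gquot_type := \pi_(Quotient.quot (gsubmod_mem P)) x.

Lemma gquot_eqP (x y : M) : gquot_pi x = gquot_pi y <-> P (x - y).
Proof.
have E : (gquot_pi x == gquot_pi y) = (x - y \in gsubmod_mem P).
  by rewrite Quotient.idealrBE.
by split=> [/eqP|H]; [rewrite E => /gsubmod_memP|apply/eqP; rewrite E; apply/gsubmod_memP].
Qed.

Lemma gquot_pi_surj (q : gquot_type) : exists x, q = gquot_pi x.
Proof. by exists (repr q); rewrite /gquot_pi reprK. Qed.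

Lemma gquot_piB : {morph gquot_pi : x y / x - y}.
Proof. exact: (raddfB (\pi_(Quotient.quot (gsubmod_mem P)))). Qed.

Definition gquot_scale (f : S) (q : gquot_type) : gquot_type :=
  gquot_pi (f *: (repr q : M)).

Lemma gquot_piZ f x : gquot_scale f (gquot_pi x) = gquot_pi (f *: x).
Proof.
apply/gquot_eqP; rewrite -scalerBr; apply: gsubmodZ.
by apply/gquot_eqP; rewrite /gquot_pi reprK.
Qed.

Lemma gquot_pi_zmod : zmod_morphism gquot_pi.
Proof. exact: gquot_piB. Qed.

HB.instance Definition _ :=
  GRing.isZmodMorphism.Build M gquot_type gquot_pi gquot_pi_zmod.

Fact gquot_scaleA f g q : gquot_scale f (gquot_scale g q) = gquot_scale (f * g) q.
Proof. by have [x ->] := gquot_pi_surj q; rewrite !gquot_piZ scalerA. Qed.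

Fact gquot_scale1 : left_id 1 gquot_scale.
Proof. by move=> q; have [x ->] := gquot_pi_surj q; rewrite gquot_piZ scale1r. Qed.

Fact gquot_scaleDr : right_distributive gquot_scale +%R.
Proof.
move=> f p q; have [[x ->] [y ->]] := (gquot_pi_surj p, gquot_pi_surj q).
by rewrite -raddfD !gquot_piZ scalerDr raddfD.
Qed.

Fact gquot_scaleDl q : {morph gquot_scale^~ q : f g / f + g}.
Proof.
by move=> f g; have [x ->] := gquot_pi_surj q; rewrite !gquot_piZ scalerDl raddfD.
Qed.

HB.instance Definition _ := GRing.Zmodule_isLmodule.Build S gquot_type
  gquot_scaleA gquot_scale1 gquot_scaleDr gquot_scaleDl.

Lemma gquot_pi_scalable : scalable gquot_pi.
Proof. by move=> f x; rewrite -gquot_piZ. Qed.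

HB.instance Definition _ :=
  GRing.isScalable.Build S M gquot_type *:%R gquot_pi gquot_pi_scalable.

Lemma gquot_is_grading :
  is_grading (fun b (q : gquot_type) => exists2 x, gcomp b x & q = gquot_pi x).
Proof.
split.
- by move=> b; exists 0; [exact: gcomp0|rewrite raddf0].
- move=> b _ _ [x hx ->] [y hy ->]; exists (x - y); last by rewrite raddfB.
  exact: gcompB.
- move=> a b f _ hf [x hx ->]; exists (f *: x); last by rewrite linearZ.
  exact: gcompZ.
- move=> q; have [x ->] := gquot_pi_surj q.
  have [s [c [us hc ->]]] := gcomp_span x.
  exists s, (gquot_pi \o c); split=> //; last by rewrite raddf_sum.
  by move=> b; exists (c b).
- move=> s c us hc e b bs.
  pose r b := sval (cid2 (hc b)).
  have hr d : gcomp d (r d) by rewrite /r; case: cid2.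
  have er d : c d = gquot_pi (r d) by rewrite /r; case: cid2.
  rewrite er -[RHS](raddf0 gquot_pi); apply/gquot_eqP; rewrite subr0.
  apply: (gsubmod_homog us hr) => //; rewrite -[X in P X]subr0; apply/gquot_eqP.
  by rewrite raddf0 raddf_sum -[RHS]e; apply: eq_bigr => d _; rewrite er.
Qed.

Definition gquot : gmod := GMod gquot_is_grading.

End Quotient.

Section Cohomology.

Section Kernel.
Variables (M N : gmod) (f : ghom M N).

Definition gker_pred (x : M) : Prop := f x = 0.

Lemma gker_homog (s : seq deg) (c : deg -> M) :
    uniq s -> (forall b, gcomp b (c b)) -> gker_pred (\sum_(b <- s) c b) ->
  forall b, b \in s -> gker_pred (c b).
Proof.
rewrite /gker_pred raddf_sum => us hc e.
by apply: (gcomp_free us (c := f \o c)) e => b; apply: ghomP.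
Qed.

Lemma gker0 : gker_pred 0. Proof. exact: raddf0. Qed.
Lemma gkerD x y : gker_pred x -> gker_pred y -> gker_pred (x + y).
Proof. by rewrite /gker_pred => hx hy; rewrite linearD /= hx hy addr0. Qed.
Lemma gkerZ g x : gker_pred x -> gker_pred (g *: x).
Proof. by rewrite /gker_pred => hx; rewrite linearZ_LR hx scaler0. Qed.

Definition gker : gsubmod M := GSubmod gker0 gkerD gkerZ gker_homog.

End Kernel.

Variables (A B C : gmod) (f : ghom A B) (g : ghom B C).

Definition gbound_pred (z : gsub (gker g)) : Prop := exists y, f y = val z.

Lemma gbound0 : gbound_pred 0. Proof. by exists 0; rewrite !raddf0. Qed.
Lemma gboundD x y : gbound_pred x -> gbound_pred y -> gbound_pred (x + y).
Proof. by move=> [u hu] [v hv]; exists (u + v); rewrite linearD /= hu hv. Qed.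
Lemma gboundZ h x : gbound_pred x -> gbound_pred (h *: x).
Proof. by move=> [u hu]; exists (h *: u); rewrite linearZ_LR hu. Qed.

Lemma gbound_homog (s : seq deg) (c : deg -> gsub (gker g)) :
    uniq s -> (forall b, gcomp b (c b)) -> gbound_pred (\sum_(b <- s) c b) ->
  forall b, b \in s -> gbound_pred (c b).
Proof.
move=> us hc [y]; have [t [u [ut hu ->]]] := gcomp_span y.
rewrite !raddf_sum => e b bs.
have := gcomp_inj us ut (c := fun b => val (c b)) (c' := f \o u) hc
  (fun b => ghomP f (hu b)) (esym e) bs.
by case: ifP => _ hb; [exists (u b)|exists 0; rewrite raddf0].
Qed.

Definition gbound : gsubmod (gsub (gker g)) :=
  GSubmod gbound0 gboundD gboundZ gbound_homog.

(* ker g / im f for A -f-> B -g-> C; g \o f = 0 is not needed, since gbound is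
   im f intersected with ker g. *)
Definition cohomology : gmod := gquot gbound.

End Cohomology.

Definition max_ideal (f : S) : Prop :=
  exists g : 'I_n -> S, f = \sum_(i < n) g i * 'X_i.

Section Torsion.
Variable M : gmod.

(* x is annihilated by m^t, i.e. by every product of t elements of m. *)
Definition killed (t : nat) (x : M) : Prop :=
  forall s : seq S, size s = t -> (forall f, f \in s -> max_ideal f) ->
    (\prod_(f <- s) f) *: x = 0.

Definition Gamma_pred (x : M) : Prop := exists t, killed t x.

Lemma max_idealX i : max_ideal 'X_i.
Proof.
exists (fun j => (j == i)%:R); rewrite (bigD1 i) //= eqxx mul1r big1 ?addr0 //.
by move=> j /negPf ->; rewrite mul0r.
Qed.

Lemma killedP t x : killed t x <->
  forall w : seq 'I_n, size w = t -> (\prod_(i <- w) 'X_i : S) *: x = 0.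
Proof.
split=> [h w hw|].
  have := h [seq 'X_i | i <- w]; rewrite size_map big_map; apply=> // f.
  by case/mapP=> i _ ->; exact: max_idealX.
elim: t x => [|t IH] x h s.
  by case: s => // _ _; have := h [::] erefl; rewrite !big_nil.
case: s => // f s [hs] hm; rewrite big_cons mulrC -scalerA.
have [|g ->] := hm f; first exact: mem_head.
rewrite scaler_suml scaler_sumr big1 // => i _.
rewrite -scalerA scalerA mulrC -scalerA.
rewrite (IH ('X_i *: x)) ?scaler0 // => [w hw|f' hf'].
  by have := h (i :: w) (congr1 succn hw); rewrite big_cons mulrC scalerA.
by apply: hm; rewrite inE hf' orbT.
Qed.

Lemma S_comp_word (w : seq 'I_n) :
  S_comp (mnm_deg (\sum_(i <- w) U_(i))) (\prod_(i <- w) 'X_i : S).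
Proof.
have -> : \prod_(i <- w) 'X_i = 'X_[\sum_(i <- w) U_(i)] :> S by elim: w => [|i w IH]; rewrite ?big_nil ?mpolyX0 // !big_cons mpolyXD IH.
by move=> m; rewrite msuppX inE => /eqP ->.
Qed.

Lemma Gamma0 : Gamma_pred 0.
Proof. by exists 0%N => s _ _; rewrite scaler0. Qed.

Lemma GammaD x y : Gamma_pred x -> Gamma_pred y -> Gamma_pred (x + y).
Proof.
move=> [p hx] [q hy]; exists (p + q)%N => s hs hm.
rewrite -(cat_take_drop p s) big_cat /= scalerDr mulrC -scalerA hx.
- rewrite scaler0 add0r mulrC -scalerA hy ?scaler0 //.
    by rewrite size_drop hs addKn.
  by move=> f /mem_drop; exact: hm.
- by rewrite size_takel // hs leq_addr.
- by move=> f /mem_take; exact: hm.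
Qed.

Lemma GammaZ g x : Gamma_pred x -> Gamma_pred (g *: x).
Proof.
by move=> [p hx]; exists p => s hs hm; rewrite scalerA mulrC -scalerA hx ?scaler0.
Qed.

Lemma Gamma_homog (s : seq deg) (c : deg -> M) :
    uniq s -> (forall b, gcomp b (c b)) -> Gamma_pred (\sum_(b <- s) c b) ->
  forall b, b \in s -> Gamma_pred (c b).
Proof.
move=> us hc [t /killedP ht] b bs; exists t; apply/killedP => w hw.
set a := mnm_deg (\sum_(i <- w) U_(i)); set X := \prod_(i <- w) _.
have := @gcomp_free M [seq a + d | d <- s] (fun d => X *: c (d - a)).
rewrite map_inj_uniq => [/(_ us)|]; last exact: addrI.
move=> /(_ _ _ (a + b)); rewrite addrAC subrr add0r; apply.
- move=> d; rewrite -{1}[d](addrNK a) addrC; apply: gcompZ; first exact: S_comp_word.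
  exact: hc.
- rewrite big_map -[RHS](ht w hw) scaler_sumr; apply: eq_bigr => d _.
  by rewrite addrAC subrr add0r.
- exact: (map_f (fun d : deg => a + d)) bs.
Qed.

Definition Gamma_sub : gsubmod M := GSubmod Gamma0 GammaD GammaZ Gamma_homog.

Definition Gamma : gmod := gsub Gamma_sub.

End Torsion.

Section TorsionMap.
Variables (M N : gmod) (f : ghom M N).

Lemma Gamma_fun_subproof (x : Gamma M) :
  f (val x) \in gsubmod_mem (Gamma_sub N).
Proof.
apply/gsubmod_memP; have /gsubmod_memP [t h] := gsub_valP x.
by exists t => s hs hm; rewrite -linearZ /= h ?raddf0.
Qed.

Definition Gamma_fun (x : Gamma M) : Gamma N := GSub (Gamma_fun_subproof x).

Fact Gamma_fun_zmod : zmod_morphism Gamma_fun.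
Proof. by move=> x y; apply: val_inj; exact: (linearB f (val x) (val y)). Qed.
HB.instance Definition _ :=
  GRing.isZmodMorphism.Build (Gamma M) (Gamma N) Gamma_fun Gamma_fun_zmod.

Fact Gamma_fun_scalable : scalable Gamma_fun.
Proof. by move=> g x; apply: val_inj; exact: (linearZ_LR f g (val x)). Qed.
HB.instance Definition _ := GRing.isScalable.Build S (Gamma M) (Gamma N) *:%R
  Gamma_fun Gamma_fun_scalable.

Fact Gamma_funP b (x : Gamma M) : gcomp b x -> gcomp b (Gamma_fun x).
Proof. by move=> hx; apply: ghomP. Qed.

Definition Gamma_map : ghom (Gamma M) (Gamma N) := @GHom _ _ Gamma_fun Gamma_funP.

End TorsionMap.

(* Injectivity in the category of Z^n-graded modules and degree 0 maps; this is
   weaker than injectivity of the underlying S-module. *)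
Definition ginjective (E : gmod) : Prop :=
  forall (A B : gmod) (f : ghom A B) (g : ghom A E), injective f ->
    exists h : ghom B E, forall x, h (f x) = g x.

(* Resolutions 0 -> M -> E^0 -> E^1 -> ..., with E^i = 0 for i < 0. A family
   [d] of maps indexed by pairs of degrees avoids casts between E^((i-1)+1) and
   E^i; only the maps [d i j] with j = i + 1 matter. *)
Record inj_resolution (M : gmod) := InjResolution {
  ires :> int -> gmod;
  ires_d : forall i j : int, ghom (ires i) (ires j);
  ires_aug : ghom M (ires 0);
  ires_inj : forall i, ginjective (ires i);
  ires_neg : forall i : int, i < 0 -> forall x : ires i, x = 0;
  ires_aug_inj : injective ires_aug;
  ires_exact0 : forall x, ires_d 0 1 x = 0 <-> exists y, ires_aug y = x;
  ires_exact : forall i j l : int, 0 <= i -> j = i + 1 -> l = j + 1 ->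
    forall x, ires_d j l x = 0 <-> exists y, ires_d i j y = x
}.

(* H^i_m(M), the i-th right derived functor of Gamma, with the Z^n-grading coming
   from the graded resolution E; up to graded isomorphism it does not depend on
   E. It vanishes for i < 0. *)
Definition local_cohomology (M : gmod) (E : inj_resolution M) (i : int) : gmod :=
  cohomology (Gamma_map (ires_d E (i - 1) i)) (Gamma_map (ires_d E i (i + 1))).

End GradedModules.

(* Main.v *)
(* Let z in Gamma(E^i) be a cocycle of degree c with c_j < 0. The complex E is
   exact in such degrees because M vanishes there, and so is its subcomplex of
   elements killed by the powers x_l^t with l <> j. Hence z = d w with w killed
   by these x_l^t. On such elements of an injective module x_j is surjective, so
   w = x_j^T v and z = x_j^T (d v), where d v is m-torsion again. Thus every
   class of degree c in H^i_m(M) is divisible by every power of x_j; but H^i_m(M),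
   being torsion and finitely generated, is killed by some power of x_j. *)
Require Import Defs.
From HB Require Import structures.
From mathcomp Require Import all_boot all_order all_algebra.
From mathcomp Require Import mpoly.
From mathcomp Require Import boolp.

Set Implicit Arguments.
Unset Strict Implicit.
Unset Printing Implicit Defensive.

Import Order.TTheory GRing.Theory Num.Theory.
Local Open Scope ring_scope.

Section Graded.
Variables (k : fieldType) (n : nat).
Local Notation S := {mpoly k[n]}.
Implicit Types (M N E : gmod k n) (b c : zdeg n).

(** * The graded modules S(-c) and their ideals of variable powers *)

Lemma S_compX (m : 'X_{1..n}) : S_comp (mnm_deg m) ('X_[m] : S).
Proof. by move=> m'; rewrite msuppX inE => /eqP ->. Qed.

Lemma S_comp_is_grading : is_grading (M := S^o) (@S_comp k n).
Proof.
split.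
- by move=> b m; rewrite msupp0.
- move=> b x y hx hy m /msuppB_le; rewrite mem_cat => /orP[/hx|/hy] //.
- move=> a b f x hf hx m /msuppM_le /allpairsP[[m1 m2] /= [h1 h2 ->]].
  rewrite -(hf _ h1) -(hx _ h2); apply/ffunP => i.
  by rewrite !ffunE mnmDE PoszD.
- move=> x; exists (undup (map (@mnm_deg n) (msupp x))).
  exists (fun b => \sum_(m <- msupp x | mnm_deg m == b) x@_m *: 'X_[m]).
  split; first exact: undup_uniq.
    move=> b m /msupp_sum_le /flattenP[s /mapP[m' ]].
    rewrite mem_filter => /andP[/eqP <- _] -> /msuppZ_le.
    by rewrite msuppX inE => /eqP ->.
  rewrite {1}[x]mpolyE (exchange_big_dep xpredT) //=.
  rewrite big_seq [RHS]big_seq; apply: eq_bigr => m hm.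
  rewrite big_mkcond (bigD1_seq (mnm_deg m)) ?undup_uniq //=; last first.
    by rewrite mem_undup map_f.
  rewrite eqxx big1 ?addr0 // => b /negPf nb.
  by rewrite eq_sym nb.
- move=> s c us hc e b bs; apply/mpolyP => m; rewrite mcoeff0.
  case hm: (m \in msupp (c b)); last by apply/eqP; rewrite mcoeff_eq0 hm.
  have := congr1 (mcoeff m) e; rewrite raddf_sum mcoeff0 /= (bigD1_seq b) //=.
  rewrite big1 ?addr0 // => d /negP nd; apply/eqP.
  rewrite mcoeff_eq0; apply/negP => /hc h; apply: nd; rewrite -h.
  by rewrite (hc _ _ hm).
Qed.

Definition Sgmod : gmod k n := GMod S_comp_is_grading.

(* S(-c): the generator 1 sits in degree c. *)
Definition Sshift (c : zdeg n) : gmod k n := translate Sgmod c.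

Section PowerIdeal.
Variables (F : seq 'I_n) (t : nat) (c : zdeg n).

(** The ideal generated by the x_l^t with [l] in [F]; being monomial, it is determined by
    supports. *)
Definition pideal_pred (f : Sshift c) : Prop :=
  forall m, m \in msupp (f : S) -> has (fun l : 'I_n => (t <= m l)%N) F.

Lemma pideal0 : pideal_pred 0.
Proof. by move=> m; rewrite msupp0. Qed.

Lemma pidealD x y : pideal_pred x -> pideal_pred y -> pideal_pred (x + y).
Proof. by move=> hx hy m /msuppD_le; rewrite mem_cat => /orP[/hx|/hy]. Qed.

Lemma pidealZ f x : pideal_pred x -> pideal_pred (f *: x).
Proof.
move=> hx m /msuppM_le /allpairsP[[m1 m2] /= [_ /hx /hasP[l lF h2] ->]].
by apply/hasP; exists l => //; rewrite mnmDE (leq_trans h2) ?leq_addl.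
Qed.

(** Homogeneous parts of distinct degrees have disjoint supports, so each monomial of a part
    survives in the sum. *)
Lemma pideal_homog (s : seq (zdeg n)) (u : zdeg n -> Sshift c) :
    uniq s -> (forall b, gcomp b (u b)) -> pideal_pred (\sum_(b <- s) u b) ->
  forall b, b \in s -> pideal_pred (u b).
Proof.
move=> us hu h b bs m hm; apply: h.
rewrite mcoeff_msupp raddf_sum /= (bigD1_seq b) //= big1 ?addr0 -?mcoeff_msupp //.
move=> d nd; apply/eqP; rewrite mcoeff_eq0; apply/negP => /hu h.
by case/eqP: nd; apply: (addIr (- c)); rewrite -h (hu _ _ hm).
Qed.

Definition pideal : gsubmod (Sshift c) :=
  GSubmod pideal0 pidealD pidealZ pideal_homog.

End PowerIdeal.

(** * Maps out of quotients and out of S(-c) *)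

Lemma gquot_pi_scale M (P : gsubmod M) f (x : M) :
  gquot_pi P (f *: x) = f *: (gquot_pi P x : gquot P).
Proof. exact: gquot_pi_scalable. Qed.

Section QuotientLift.
Variables (M N : gmod k n) (P : gsubmod M) (f : ghom M N).
Hypothesis fP : forall x, P x -> f x = 0.

(** The choice of representative does not matter because [f] vanishes on [P]. *)
Definition gquot_lift_fun (q : gquot P) : N := f (repr q : M).

Lemma gquot_lift_pi x : gquot_lift_fun (gquot_pi P x) = f x.
Proof.
apply/eqP; rewrite -subr_eq0 -linearB; apply/eqP/fP.
by apply/gquot_eqP; rewrite /gquot_pi reprK.
Qed.

Fact gquot_lift_zmod : zmod_morphism gquot_lift_fun.
Proof.
move=> p q; have [[x ->] [y ->]] := (gquot_pi_surj p, gquot_pi_surj q).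
by rewrite -gquot_piB !gquot_lift_pi linearB.
Qed.
HB.instance Definition _ :=
  GRing.isZmodMorphism.Build (gquot P) N gquot_lift_fun gquot_lift_zmod.

Fact gquot_lift_scalable : scalable gquot_lift_fun.
Proof.
move=> a q; have [x ->] := gquot_pi_surj q.
by rewrite -gquot_pi_scalable !gquot_lift_pi linearZ_LR.
Qed.
HB.instance Definition _ := GRing.isScalable.Build S (gquot P) N *:%R
  gquot_lift_fun gquot_lift_scalable.

Fact gquot_lift_gcomp b (q : gquot P) : gcomp b q -> gcomp b (gquot_lift_fun q).
Proof. by move=> [x hx ->]; rewrite gquot_lift_pi; apply: ghomP. Qed.

Definition gquot_lift : ghom (gquot P) N := GHom gquot_lift_gcomp.

Lemma gquot_liftE x : gquot_lift (gquot_pi P x) = f x.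
Proof. exact: gquot_lift_pi. Qed.

End QuotientLift.

Section OrbitHom.
Variables (N : gmod k n) (c : zdeg n) (u : N).
Hypothesis hu : gcomp c u.

(** The map S(-c) -> N with 1 |-> u, which preserves degrees as [u] has degree [c]. *)
Definition orbit_fun (f : Sshift c) : N := (f : S) *: u.

Fact orbit_zmod : zmod_morphism orbit_fun.
Proof. by move=> f g; rewrite /orbit_fun scalerBl. Qed.
HB.instance Definition _ :=
  GRing.isZmodMorphism.Build (Sshift c) N orbit_fun orbit_zmod.

Fact orbit_scalable : scalable orbit_fun.
Proof. by move=> a f; rewrite /orbit_fun scalerA. Qed.
HB.instance Definition _ := GRing.isScalable.Build S (Sshift c) N *:%R
  orbit_fun orbit_scalable.

Fact orbit_gcomp b f : gcomp b f -> gcomp b (orbit_fun f).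
Proof. by move=> hf; rewrite -(subrK c b); apply: gcompZ. Qed.

Definition orbit_hom : ghom (Sshift c) N := GHom orbit_gcomp.

End OrbitHom.

(** * Elements killed by variable powers, and divisibility in injectives *)

Definition pkilled M (F : seq 'I_n) (t : nat) (x : M) : Prop :=
  forall l, l \in F -> ('X_l ^+ t : S) *: x = 0.

Lemma monomial_split (m : 'X_{1..n}) (l : 'I_n) t : (t <= m l)%N ->
  'X_[m] = 'X_[m - (U_(l) *+ t)] * 'X_l ^+ t :> S.
Proof.
move=> h; rewrite mpolyXn -mpolyXD; congr ('X_[_]); apply/mnmP => i.
rewrite mnmDE mnmBE mulmnE mnm1E; case: eqP => [<-|_]; last by rewrite addn0 subn0.
by rewrite mul1n subnK.
Qed.

Lemma pideal_kills N F t c (u : N) (f : Sshift c) :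
  pkilled F t u -> pideal F t c f -> (f : S) *: u = 0.
Proof.
move=> hu hf; rewrite [f : S]mpolyE scaler_suml big1_seq // => m /= /hf.
case/hasP=> l lF h; rewrite (monomial_split h) -mul_mpolyC mulrA -scalerA.
by rewrite hu // scaler0.
Qed.

(** The generators x_l^t do not involve x_a, so cancelling x_a^r leaves the relevant exponents
    unchanged. *)
Lemma pideal_colon F t r (a : 'I_n) c d (f : S) : a \notin F ->
  pideal F t d (f * 'X_a ^+ r) -> pideal F t c f.
Proof.
move=> aF h m hm.
have := h (m + (U_(a) *+ r))%MM.
rewrite mpolyXn mcoeff_msupp [(m + _)%MM]addmC mcoeffMX -mcoeff_msupp addmC => /(_ hm) /hasP[l lF].
rewrite mnmDE mulmnE mnm1E; case: eqP => [e|_]; first by rewrite e lF in aF.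
by rewrite addn0 => h'; apply/hasP; exists l.
Qed.

(* Multiplication by x_a^r embeds S/(x_l^t : l in F)(-c) into a shift of itself,
   since x_a is regular on it; injectivity extends 1 |-> u along this map. *)
Lemma ginjective_divisible E (F : seq 'I_n) t r (a : 'I_n) c (u : E) :
    ginjective E -> a \notin F -> gcomp c u -> pkilled F t u ->
  exists v : E, [/\ gcomp (c - mnm_deg (U_(a) *+ r)) v, 'X_a ^+ r *: v = u
                  & pkilled F t v].
Proof.
(* With 1 placed in degree [d], the element x_a^r of S(-d) has degree [c]. *)
move=> injE aF cu Fu; set d := c - _.
pose Q e := gquot (pideal F t e).
pose pi e : {linear Sshift e -> Q e} := gquot_pi (pideal F t e).
have cXa : gcomp c (pi d ('X_a ^+ r : S)).
  exists ('X_a ^+ r : S) => //; rewrite mpolyXn /=.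
  by rewrite /d opprB addrC subrK; apply: S_compX.
have Xa0 (f : Sshift c) : pideal F t c f -> orbit_hom cXa f = 0.
  move=> hf; rewrite /= /orbit_fun -gquot_pi_scale -[RHS](raddf0 (pi d)).
  apply/gquot_eqP; rewrite subr0.
  have -> : (f : S) *: ('X_a ^+ r : Sshift d) = ('X_a ^+ r : S) *: (f : Sshift d).
    exact: mulrC.
  exact: (pidealZ (c := d)).
have u0 (f : Sshift c) : pideal F t c f -> orbit_hom cu f = 0.
  exact: pideal_kills.
have injX : injective (gquot_lift Xa0).
  move=> p q; have [[x ->] [y ->]] := (gquot_pi_surj p, gquot_pi_surj q).
  rewrite !gquot_liftE /= /orbit_fun -!gquot_pi_scale => /gquot_eqP h.
  apply/gquot_eqP; apply: (@pideal_colon F t r a c d) => //.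
  by rewrite mulrBl.
have [h hE] := injE _ _ _ (gquot_lift u0) injX.
(* In [Q d], x_a^r times the class of 1 is the image of the class of 1 from [Q c], and [h] sends
   that image to [u]. *)
exists (h (pi d (1 : S))); split.
- apply: ghomP; exists (1 : S) => //=; rewrite subrr -mpolyX0.
  move=> m; rewrite msuppX inE => /eqP ->.
  by apply/ffunP => i; rewrite !ffunE mnm0E.
- have := hE (pi c (1 : S)); rewrite !gquot_liftE /= /orbit_fun.
  by rewrite !scale1r => <-; rewrite -linearZ_LR -gquot_pi_scale /= [_ *: _]mulr1.
- move=> l lF; rewrite -linearZ_LR -[RHS](raddf0 h); congr (h _).
  rewrite -gquot_pi_scale -[RHS](raddf0 (pi d)); apply/gquot_eqP; rewrite subr0.
  rewrite [_ *: _]mulr1 => m; rewrite mpolyXn msuppX inE => /eqP ->.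
  by apply/hasP; exists l => //; rewrite mulmnE mnm1E eqxx mul1n.
Qed.

(** A degree-preserving map sends the component of [y] in degree [c] to that of [f y], which is all
    of [f y]. *)
Lemma ghom_homog_preimage M N (f : ghom M N) c y :
  gcomp c (f y) -> exists2 x, gcomp c x & f x = f y.
Proof.
move=> cfy; have [s [u [us hu e]]] := gcomp_span y.
have hc b : gcomp b (if b == c then f y else 0).
  by case: eqP => [->//|_]; exact: gcomp0.
have := @gcomp_inj _ _ _ [:: c] s _ (f \o u) isT us hc (fun b => ghomP f (hu b)).
rewrite big_seq1 eqxx {1}e raddf_sum => /(_ erefl c (mem_head _ _)).
rewrite eqxx; case: ifP => _ ->; first by exists (u c).
(* Here [c] does not occur in the decomposition of [y], so [f y] is 0. *)
by exists 0; [exact: gcomp0|exact: raddf0].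
Qed.

(** * Exactness of the resolution in degrees with a negative coordinate *)

Section Resolution.
Variables (M : gmod k n) (E : inj_resolution M).
Hypothesis natM : nat_graded M.

Lemma ires_dd (i j l : int) (x : E i) : j = i + 1 -> l = j + 1 ->
  ires_d E j l (ires_d E i j x) = 0.
Proof.
move=> ej el; case: (leP 0 i) => hi.
  by apply/(ires_exact hi ej el); exists x.
by rewrite (ires_neg hi x) !raddf0.
Qed.

(** For [0 <= h] this is exactness with a homogeneous preimage. At the left end the kernel in [E 0]
    is the image of [M], whose part of degree [c] is zero since [c a < 0]. *)
Lemma ires_exact_neg (a : 'I_n) c (h i l : int) (z : E i) :
    c a < 0 -> i = h + 1 -> l = i + 1 -> gcomp c z -> ires_d E i l z = 0 ->
  exists2 w, gcomp c w & ires_d E h i w = z.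
Proof.
move=> ca ei el cz dz; case: (leP 0 h) => hh.
  have /(ires_exact hh ei el) [w e] := dz.
  by rewrite -e in cz *; apply: ghom_homog_preimage.
suff -> : z = 0 by exists 0; [exact: gcomp0|exact: raddf0].
case: (ltP i 0) => hi; first exact: ires_neg.
(* Here [h < 0] and [0 <= i], so [i = h + 1] forces [i = 0]. *)
have i0 : i = 0 by apply/eqP; rewrite eq_le hi andbT ei -ltzD1 ltrD2r.
move: z cz dz; rewrite el; clear ei el hi; subst i => z cz.
move=> /ires_exact0 [y e]; rewrite -e in cz *.
have [x cx <-] := ghom_homog_preimage cz.
rewrite (natM _ cx) ?raddf0 // => /(_ a).
by rewrite leNgt ca.
Qed.

(* This is the vanishing of Ext(S/(x_l^t : l in F)(-c), M), by induction on F: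
   correct a primitive w of z by the boundary of v, where x_b^t v is a primitive
   of x_b^t w. Since a is not in F the shifts never change the a-th degree. *)
Lemma ires_exact_pkilled (a : 'I_n) (F : seq 'I_n) t : uniq (a :: F) ->
  forall c (h i l : int) (z : E i),
    c a < 0 -> i = h + 1 -> l = i + 1 -> gcomp c z -> ires_d E i l z = 0 ->
    pkilled F t z ->
  exists w, [/\ gcomp c w, ires_d E h i w = z & pkilled F t w].
Proof.
elim: F => [_|b F IH].
  move=> c h i l z ca ei el cz dz _.
  by have [w cw dw] := ires_exact_neg ca ei el cz dz; exists w.
rewrite /= inE negb_or => /andP[/andP[ab aF] /andP[bF uF]].
have {}IH := IH (introT andP (conj aF uF)).
move=> c h i l z ca ei el cz dz Fz.
have Fz' : pkilled F t z by move=> m mF; apply: Fz; rewrite inE mF orbT.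
have [w [cw dw Fw]] := IH _ _ _ _ _ ca ei el cz dz Fz'.
set d := mnm_deg (U_(b) *+ t).
have da : (d + c) a = c a.
  by rewrite !ffunE mulmnE mnm1E eq_sym (negPf ab) mul0n add0r.
have cv : gcomp (d + c) ('X_b ^+ t *: w).
  by apply: gcompZ => //; rewrite mpolyXn; exact: S_compX.
(* Since x_b^t kills [z], the product x_b^t w is a cocycle. *)
have dv : ires_d E h i ('X_b ^+ t *: w) = 0.
  by rewrite linearZ_LR dw Fz ?mem_head.
have Fv : pkilled F t ('X_b ^+ t *: w).
  by move=> m /Fw e; rewrite scalerA mulrC -scalerA e scaler0.
have eh : h = h - 1 + 1 by rewrite subrK.
have dca : (d + c) a < 0 by rewrite da.
(* The induction hypothesis again, one place further left and in degree [d + c]. *)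
have [u [cu du Fu]] := IH _ _ _ _ _ dca eh ei cv dv Fv.
have [v [cv' ev Fv']] := ginjective_divisible t (@ires_inj _ _ _ E _) bF cu Fu.
rewrite addrAC subrr add0r in cv'.
exists (w - ires_d E (h - 1) h v); split.
- by apply: gcompB => //; exact: ghomP.
- by rewrite linearB /= dw ires_dd ?subr0.
- move=> m; rewrite inE scalerBr -linearZ_LR => /orP[/eqP ->|mF].
    by rewrite ev du subrr.
  by rewrite Fw // Fv' // raddf0 subr0.
Qed.

End Resolution.

(** * Torsion and finite generation *)

Lemma pkilled_all_killed M s (x : M) :
  (forall l, ('X_l ^+ s : S) *: x = 0) -> (0 < n)%N -> killed (n * s) x.
Proof.
move=> hx n0; apply/killedP => w hw.
have -> : \prod_(i <- w) 'X_i = 'X_[\sum_(i <- w) U_(i)] :> S.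
  elim: (w) => [|i w' IH]; rewrite ?big_nil ?mpolyX0 // !big_cons.
  by rewrite mpolyXD IH.
(* Pigeonhole: a word of length [n * s] in [n] letters contains some letter at least [s] times;
   otherwise its length would be at most [n * s.-1], which is smaller as [0 < n]. *)
have [l hl] : exists l, (s <= (\sum_(i <- w) U_(i))%MM l)%N.
  apply/existsP; apply: contraT; rewrite negb_exists => /forallP hl.
  have : (\sum_(l < n) (\sum_(i <- w) U_(i))%MM l)%N = (n * s)%N.
    rewrite -mdegE mdeg_sum -hw; rewrite -sum1_size.
    by apply: eq_bigr => i _; rewrite mdeg1.
  have s0 : (0 < s)%N.
    by have := hl (Ordinal n0); rewrite -ltnNge; apply: leq_trans.
  move=> e; have : (n * s <= n * s.-1)%N.
    rewrite -e -[X in (_ <= X * _)%N]card_ord -sum_nat_const; apply: leq_sum => l _.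
    by rewrite -ltnS prednK // ltnNge.
  by rewrite leq_pmul2l // -ltnS prednK // ltnn.
by rewrite (monomial_split hl) -scalerA hx scaler0.
Qed.

(** By commutativity, what kills all generators kills the module; the largest of their finitely many
    exponents serves for every variable. *)
Lemma fin_gen_torsion M : fin_gen M -> (forall x : M, exists t, killed t x) ->
  exists T, forall (j : 'I_n) (x : M), ('X_j ^+ T : S) *: x = 0.
Proof.
move=> [r [g gen]] tors.
have [t ht] : exists t : 'I_r -> nat, forall i, killed (t i) (g i).
  by exists (fun i => sval (cid (tors (g i)))) => i; case: cid.
exists (\max_i t i)%N => j x; have [c ->] := gen x.
rewrite scaler_sumr big1 // => i _; rewrite scalerA mulrC -scalerA.
have /subnK <- : (t i <= \max_i t i)%N by exact: leq_bigmax.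
have /killedP/(_ (nseq (t i) j)) := ht i.
rewrite size_nseq big_nseq iter_mulr_1 => /(_ erefl) e.
by rewrite exprD -scalerA e !scaler0.
Qed.

End Graded.

(** * Torsion and divisibility of local cohomology *)

Lemma local_cohomology_torsion (k : fieldType) (n : nat) (M : gmod k n)
    (E : inj_resolution M) (i : int) (x : local_cohomology E i) :
  exists t, killed t x.
Proof.
have [z ->] := gquot_pi_surj x.
(* A power of m killing a representing cocycle also kills its class. *)
have /gsubmod_memP [t ht] := gsub_valP (val z).
exists t => s hs hm; rewrite -gquot_pi_scale -[RHS](raddf0 (gquot_pi _)).
congr (gquot_pi _); do 2 apply: val_inj; exact: ht.
Qed.

Lemma local_cohomology_divisible (k : fieldType) (n : nat) (M : gmod k n)
    (E : inj_resolution M) (i : int) (j : 'I_n) (c : zdeg n) T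
    (x : local_cohomology E i) :
  nat_graded M -> c j < 0 -> gcomp c x ->
  exists y : local_cohomology E i, ('X_j ^+ T : {mpoly k[n]}) *: y = x.
Proof.
move=> natM cj [z cz ->].
have /gsubmod_memP [t /killedP ht] := gsub_valP (val z).
have kz l : 'X_l ^+ t *: val (val z) = 0.
  by have := ht (nseq t l); rewrite size_nseq big_nseq iter_mulr_1; apply.
have dz : ires_d E i (i + 1) (val (val z)) = 0.
  by have /gsubmod_memP /(congr1 val) := gsub_valP z.
(* Leaving x_j out keeps it regular modulo the remaining powers, so that [w] can be divided by
   it. *)
pose F := [seq l <- enum 'I_n | l != j].
have uF : uniq (j :: F).
  by rewrite /= mem_filter eqxx filter_uniq // enum_uniq.
have ei : i = i - 1 + 1 by rewrite subrK.
have [w [cw dw Fw]] :=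
  ires_exact_pkilled natM uF cj ei erefl cz dz (fun l _ => kz l).
have [jF _] := andP uF.
have [v [cv ev Fv]] := ginjective_divisible T (@ires_inj _ _ _ E _) jF cw Fw.
set y := ires_d E (i - 1) i v.
have ey : 'X_j ^+ T *: y = val (val z) by rewrite -linearZ_LR ev.
(* For [l] other than [j], x_l^t kills [v]; and x_j^T y is the cocycle, killed by x_j^t. The
   exponent [t + T] covers both cases. *)
have ky l : 'X_l ^+ (t + T) *: y = 0.
  have [->|lj] := eqVneq l j; first by rewrite exprD -scalerA ey kz.
  rewrite addnC exprD -scalerA -(linearZ_LR (ires_d E (i - 1) i)) Fv ?raddf0 ?scaler0 //.
  by rewrite mem_filter lj mem_enum.
(* Although [y] is a boundary in [E], [v] need not be m-torsion, so the class of [y] may be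
   nonzero. *)
have Gy : y \in gsubmod_mem (Gamma_sub (E i)).
  apply/gsubmod_memP; exists (n * (t + T))%N; apply: pkilled_all_killed => //.
  exact: leq_ltn_trans (ltn_ord j).
have Zy : (GSub Gy : Gamma (E i)) \in
    gsubmod_mem (gker (Gamma_map (ires_d E i (i + 1)))).
  by apply/gsubmod_memP/val_inj => /=; exact: ires_dd.
pose P := gbound (Gamma_map (ires_d E (i - 1) i))
                 (Gamma_map (ires_d E i (i + 1))).
exists (gquot_pi P (GSub Zy)); rewrite -gquot_pi_scale.
by congr (gquot_pi _); do 2 apply: val_inj.
Qed.

Theorem lemma3p10 (k : fieldType) (n : nat) (M : gmod k n)
    (E : inj_resolution M) (i : int) :
  fin_gen M -> nat_graded M ->
  fin_gen (local_cohomology E i) ->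
  nat_graded (translate (local_cohomology E i) [ffun _ => 1]).
Proof.
move=> _ natM fgH b nb x cx.
have [T hT] := fin_gen_torsion fgH (@local_cohomology_torsion _ _ _ E i).
have [j bj] : exists j, b j < 0.
  apply: contra_notP nb => h j; rewrite leNgt; apply/negP => bj.
  by apply: h; exists j.
(* The translate in degree [b] is local cohomology in degree b - 1, whose [j]-th coordinate is still
   negative. *)
have cj : (b - [ffun _ => 1] : zdeg n) j < 0.
  by rewrite !ffunE subr_lt0 (lt_trans bj).
have [y <-] := local_cohomology_divisible T natM cj cx.
exact: hT.
Qed.
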